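(* The following identities hold: $$\sum_{k=1}^\infty\frac{\binom{4k}{k}\left((11k^2+8k+1)H_k+6k+6+\frac{4}{3k}\right)}{(3k+1)(3k+2)16^k}=\frac{4}{3}\log 2,$$ $$\sum_{k=0}^\infty\frac{\binom{4k}{k}\left((11k^2+8k+1)\left(H_{2k}-\frac{5}{4}H_k\right)+4k+1\right)}{(3k+1)(3k+2)16^k}=\log 2,$$ and $$\sum_{k=0}^\infty\frac{\binom{4k}{k}\left((11k^2+8k+1)(10H_{4k}-17H_{2k})+2k+18\right)}{(3k+1)(3k+2)16^k}=8\log 2.$$
   Context: For $n\in\{0,1,2,\ldots\}$, $H_n=\sum_{0<k\le n}\frac1k$ denotes the $n$-th harmonic number (so $H_0=0$). $\log$ is the natural logarithm. *)

(* Defs.v *)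
From Stdlib Require Import Reals.
From Coquelicot Require Import Coquelicot.
Local Open Scope R_scope.

(* [sum_n_m] over the empty range 1..0 is zero, so [harmonic 0 = 0]. *)
Definition harmonic (n : nat) : R := sum_n_m (fun k : nat => / INR k) 1 n.

(* [Binomial.C] is the real-valued binomial coefficient; the bare name [C] is
   shadowed by Coquelicot's complex numbers. *)
Definition binom (n k : nat) : R := Binomial.C n k.

(* Main.v *)
Require Import Defs.
From Stdlib Require Import Reals Factorial Lra Lia.
From Coquelicot Require Import Coquelicot.
Local Open Scope R_scope.

(** The generating function W(z) of the numbers binom(4k,k)/(3k+1) satisfies
    W = 1 + z W^4, so every sum of binom(4k,k) R(k) z^k with R a combination of
    1, k/((3k+1)(3k+2)) and 1/((3k+1)(3k+2)) is a rational function of W.  In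
    particular, with P(k) = 11k^2+8k+1, the series f(z) of
    binom(4k,k) P(k)/((3k+1)(3k+2)) z^k is (W^3/2+W^2-W)/(4-3W), and
    1 - f(z) = (8-4W-2W^2-W^3)/(2(4-3W)).

    A harmonic number is an integral over [0,1]:  H_{dk} is the integral of
    e x^(e-1) (1-x^(4k))/(1-x^e) when d e = 4.  Hence the sum of the k-th
    coefficient of f, divided by 16^k, times H_{dk} is the integral of
    e x^(e-1) (1 - f(x^4/16))/(1-x^e), provided f(1/16) = 1.  Writing W = 1+v^4,
    the equation of W becomes x = 2v/(1+v^4): the curve is rational and v
    uniformizes it.  Moreover 16(W-1) - W^4 = (2-W)(W^3+2W^2+4W-8), so the cubic
    in the numerator of 1 - f cancels against 1 - x^4; this is what singles out
    P, and it explains f(1/16) = 1.  The factor 4-3W cancels against dx/dv.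
    What remains is the integral of a rational function of v whose poles are at
    eighth roots of unity; its primitive combines logarithms of 1-v^m and 1+v^m
    for m = 1, 2, 4 with a polynomial ([is_series_weight_harmonic] and its three
    instances).  The series with an extra factor 1/k is treated the same way
    ([is_series_coef_div_k]).

    At x = 1 the value u of v satisfies u^3+u^2+u = 1.  Then (1-u)^3 = 2u^5, so
    that all the logarithms are combinations of log 2 and log u
    ([prim_values_at_root]).  In each of the three identities log u and the
    polynomials in u cancel, leaving a multiple of log 2. *)

(** * Raney numbers and their convolution *)

(** The coefficients r/(4n+r) binom(4n+r,n) of the r-th power of W.  The
    recursion is W^(r+1) = W^r + z W^(r+4) read coefficientwise; it makes the
    convolution identity an easy double induction and leaves the closed form
    to be checked separately. *)
Fixpoint raney (n : nat) : nat -> R :=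
  match n with
  | O => fun _ => 1
  | S m => fix row (r : nat) : R :=
      match r with
      | O => 0
      | S q => row q + raney m (q + 4)
      end
  end.

Lemma raney_S_S (n q : nat) :
  raney (S n) (S q) = raney (S n) q + raney n (q + 4).
Proof. reflexivity. Qed.

Lemma raney_S_0 (n : nat) : raney (S n) 0 = 0.
Proof. reflexivity. Qed.

Lemma raney_closed_form (n q : nat) :
  raney n (S q) =
    INR (S q) * INR (fact (4 * n + q)) / (INR (fact n) * INR (fact (3 * n + q + 1))).
Proof.
  revert q; induction n as [|n IHn]; intros q.
  - replace (4 * 0 + q)%nat with q by lia.
    replace (3 * 0 + q + 1)%nat with (S q) by lia.
    rewrite (fact_simpl q), mult_INR; simpl raney.
    change (fact 0) with 1%nat; rewrite INR_1.
    field; split; [apply INR_fact_neq_0 | apply not_0_INR; lia].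
  - induction q as [|q IHq]; rewrite raney_S_S.
    + change (0 + 4)%nat with 4%nat; rewrite raney_S_0, IHn.
      replace (4 * S n + 0)%nat with (S (4 * n + 3)) by lia.
      replace (3 * S n + 0 + 1)%nat with (3 * n + 3 + 1)%nat by lia.
      rewrite (fact_simpl n), (fact_simpl (4 * n + 3)), !mult_INR, !S_INR, !plus_INR,
        !mult_INR; simpl INR.
      field; repeat split; try apply INR_fact_neq_0.
      pose proof (pos_INR n); lra.
    + rewrite IHq.
      replace (S q + 4)%nat with (S (q + 4)) by lia.
      rewrite IHn.
      replace (4 * S n + S q)%nat with (S (4 * n + (q + 4))) by lia.
      replace (4 * S n + q)%nat with (4 * n + (q + 4))%nat by lia.
      replace (3 * S n + q + 1)%nat with (3 * n + q + 4)%nat by lia.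
      replace (3 * S n + S q + 1)%nat with (S (3 * n + q + 4)) by lia.
      replace (3 * n + (q + 4) + 1)%nat with (S (3 * n + q + 4)) by lia.
      rewrite (fact_simpl n), (fact_simpl (4 * n + (q + 4))),
        (fact_simpl (3 * n + q + 4)), !mult_INR, !S_INR, !plus_INR, !mult_INR;
        simpl INR.
      pose proof (pos_INR n); pose proof (pos_INR q).
      field; repeat split; try apply INR_fact_neq_0; lra.
Qed.

Lemma binom_4k_k (k : nat) : binom (4 * k) k = (3 * INR k + 1) * raney k 1.
Proof.
  unfold binom, Binomial.C; rewrite raney_closed_form.
  replace (4 * k - k)%nat with (3 * k)%nat by lia.
  replace (4 * k + 0)%nat with (4 * k)%nat by lia.
  replace (3 * k + 0 + 1)%nat with (S (3 * k)) by lia.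
  rewrite (fact_simpl (3 * k)), !mult_INR, !S_INR, mult_INR; simpl INR.
  pose proof (pos_INR k).
  field; repeat split; try apply INR_fact_neq_0; lra.
Qed.

Lemma raney_2 (k : nat) :
  (3 * INR k + 2) * raney k 2 = (8 * INR k + 2) * raney k 1.
Proof.
  rewrite !raney_closed_form.
  replace (4 * k + 1)%nat with (S (4 * k)) by lia.
  replace (4 * k + 0)%nat with (4 * k)%nat by lia.
  replace (3 * k + 1 + 1)%nat with (S (3 * k + 1)) by lia.
  replace (3 * k + 0 + 1)%nat with (3 * k + 1)%nat by lia.
  rewrite (fact_simpl (4 * k)), (fact_simpl (3 * k + 1)), !mult_INR, !S_INR, plus_INR,
    !mult_INR; simpl INR.
  pose proof (pos_INR k).
  field; repeat split; try apply INR_fact_neq_0; lra.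
Qed.

Lemma raney_pos (n r : nat) : 0 <= raney n r.
Proof.
  revert r; induction n as [|n IHn]; intros r; [simpl; lra |].
  induction r as [|q IHq]; [simpl; lra |].
  rewrite raney_S_S; specialize (IHn (q + 4)%nat); lra.
Qed.

(** For fixed n, the two sides have the same increment in r, by the identity
    for n-1 at r+4, and they agree at r = 0. *)
Lemma raney_convolution (n r s : nat) :
  sum_f_R0 (fun k => raney k r * raney (n - k) s) n = raney n (r + s).
Proof.
  revert r; induction n as [|n IHn]; intros r; [simpl; ring |].
  induction r as [|q IHq].
  - rewrite decomp_sum by lia; simpl pred.
    rewrite (sum_eq _ (fun _ => 0)).
    + rewrite sum_cte, Nat.sub_0_r, Nat.add_0_l; simpl (raney 0 0); ring.
    + intros i Hi; rewrite raney_S_0; ring.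
  - replace (S q + s)%nat with (S (q + s)) by lia.
    rewrite raney_S_S, <- IHq.
    replace (q + s + 4)%nat with (q + 4 + s)%nat by lia.
    rewrite <- IHn.
    rewrite !(decomp_sum _ (S n)) by lia; simpl pred.
    rewrite Rplus_assoc, <- plus_sum; f_equal.
    apply sum_eq; intros i Hi.
    rewrite raney_S_S, Nat.sub_succ; ring.
Qed.

(** The ratio 27/256 is (y-1)/y^4 at its maximum y = 4/3, so that
    y^r + (27/256) y^(r+4) = y^(r+1): the bound propagates along the recursion.
    It gives both the convergence of the generating functions and W <= 4/3. *)
Lemma raney_partial_sum_le (N r : nat) :
  sum_f_R0 (fun n => raney n r * (27 / 256) ^ n) N <= (4 / 3) ^ r.
Proof.
  revert r; induction N as [|N IHN]; intros r.
  - simpl; rewrite Rmult_1_r; apply pow_R1_Rle; lra.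
  - induction r as [|q IHq].
    + rewrite decomp_sum by lia; simpl pred.
      rewrite (sum_eq _ (fun _ => 0)).
      * rewrite sum_cte; simpl; lra.
      * intros i Hi; rewrite raney_S_0; ring.
    + rewrite decomp_sum in * by lia; simpl pred in *.
      rewrite (sum_eq _ (fun i => raney (S i) q * (27 / 256) ^ S i
        + raney i (q + 4) * (27 / 256) ^ i * (27 / 256))).
      * rewrite plus_sum, <- scal_sum.
        specialize (IHN (q + 4)%nat).
        rewrite pow_add in IHN.
        change ((4 / 3) ^ S q) with (4 / 3 * (4 / 3) ^ q).
        simpl raney in *; lra.
      * intros i Hi; rewrite raney_S_S; simpl pow; ring.
Qed.

(** * The generating function W and its algebraic equation *)

Lemma raney_CV_radius (r : nat) (z : R) :
  Rabs z < 27 / 256 -> Rbar_lt (Rabs z) (CV_radius (fun n => raney n r)).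
Proof.
  intros Hz; apply Rbar_lt_le_trans with (27 / 256); [exact Hz |].
  apply (CV_radius_bounded (fun n => raney n r)).
  exists ((4 / 3) ^ r); intros n.
  pose proof (fun m => Rmult_le_pos _ _ (raney_pos m r) (pow_le (27 / 256) m ltac:(lra)))
    as Hpos.
  rewrite Rabs_pos_eq by apply Hpos.
  apply Rle_trans with (2 := raney_partial_sum_le n r).
  destruct n as [|n]; [apply Rle_refl |].
  rewrite tech5; pose proof (cond_pos_sum _ n Hpos); lra.
Qed.

Definition raney_gf (r : nat) (z : R) : R := PSeries (fun n => raney n r) z.

Lemma is_series_raney (r : nat) (z : R) :
  Rabs z < 27 / 256 -> is_series (fun n => raney n r * z ^ n) (raney_gf r z).
Proof.
  intros Hz; apply is_pseries_R, PSeries_correct, CV_radius_inside.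
  now apply raney_CV_radius.
Qed.

Lemma raney_gf_add (r s : nat) (z : R) :
  Rabs z < 27 / 256 -> raney_gf (r + s) z = raney_gf r z * raney_gf s z.
Proof.
  intros Hz; unfold raney_gf.
  rewrite <- PSeries_mult by now apply raney_CV_radius.
  apply PSeries_ext; intros n; symmetry; apply raney_convolution.
Qed.

Lemma raney_gf_2 (z : R) : Rabs z < 27 / 256 -> raney_gf 2 z = raney_gf 1 z ^ 2.
Proof. intros Hz; rewrite (raney_gf_add 1 1 z Hz : raney_gf 2 z = _); ring. Qed.

Lemma raney_gf_equation (z : R) :
  Rabs z < 27 / 256 -> raney_gf 1 z = 1 + z * raney_gf 1 z ^ 4.
Proof.
  intros Hz.
  replace (raney_gf 1 z ^ 4) with (raney_gf 4 z).
  2: { rewrite (raney_gf_add 2 2 z Hz : raney_gf 4 z = _), raney_gf_2 by exact Hz; ring. }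
  unfold raney_gf at 1; rewrite PSeries_decr_1.
  2: { apply CV_radius_inside; now apply raney_CV_radius. }
  simpl (raney 0 1); do 2 f_equal.
  apply PSeries_ext; intros n; unfold PS_decr_1.
  rewrite raney_S_S, raney_S_0; apply Rplus_0_l.
Qed.

Lemma CV_radius_INR_mult (a : nat -> R) :
  CV_radius (fun k => INR k * a k) = CV_radius a.
Proof.
  rewrite <- (CV_radius_derive a), <- (CV_radius_incr_1 (PS_derive a)).
  apply CV_radius_ext; intros [|k]; [apply Rmult_0_l | reflexivity].
Qed.

(** Differentiating W = 1 + z W^4 and eliminating z gives W' (4-3W) = W^5.  The
    equation is kept free of division because it is used to show that 4-3W
    does not vanish. *)
Lemma raney_gf_derive (z : R) :
  Rabs z < 27 / 256 ->
  exists W', is_derive (raney_gf 1) z W' /\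
    W' * (4 - 3 * raney_gf 1 z) = raney_gf 1 z ^ 5 /\
    is_series (fun k => INR k * raney k 1 * z ^ k) (z * W').
Proof.
  intros Hz.
  pose proof (raney_CV_radius 1 z Hz) as Hr.
  exists (PSeries (PS_derive (fun n => raney n 1)) z); split; [| split].
  - now apply is_derive_PSeries.
  - set (W' := PSeries _ z).
    assert (HW : is_derive (raney_gf 1) z W') by now apply is_derive_PSeries.
    assert (HE : is_derive (fun t => 1 + t * raney_gf 1 t ^ 4) z W').
    { apply is_derive_ext_loc with (2 := HW).
      apply locally_open with (D := fun t => Rabs t < 27 / 256); [| | exact Hz].
      - apply (open_comp Rabs (fun y => y < 27 / 256)).
        + intros x _; apply continuous_Rabs.
        + apply open_lt.
      - intros t Ht; now apply raney_gf_equation. }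
    assert (HF : is_derive (fun t => 1 + t * raney_gf 1 t ^ 4) z
      (raney_gf 1 z ^ 4 + 4 * z * raney_gf 1 z ^ 3 * W')).
    { auto_derive; [repeat split; now exists W' |].
      change (Derive (fun t => raney_gf 1 t) z) with (Derive (raney_gf 1) z).
      rewrite (is_derive_unique _ _ _ HW); ring. }
    assert (Heq : W' = raney_gf 1 z ^ 4 + 4 * z * raney_gf 1 z ^ 3 * W').
    { exact (eq_trans (eq_sym (is_derive_unique _ _ _ HE)) (is_derive_unique _ _ _ HF)). }
    pose proof (raney_gf_equation z Hz) as Hfun.
    set (W := raney_gf 1 z) in *.
    assert (HzW : z * W ^ 4 = W - 1) by lra.
    assert (HWW' : W * W' = W ^ 5 + 4 * (z * W ^ 4) * W') by (rewrite Heq at 1; ring).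
    rewrite HzW in HWW'; lra.
  - rewrite <- PSeries_incr_1.
    apply (is_series_ext (fun k => PS_incr_1 (PS_derive (fun n => raney n 1)) k * z ^ k)).
    { intros [|k]; [simpl; unfold zero; simpl; ring | reflexivity]. }
    apply is_pseries_R, PSeries_correct, CV_radius_inside.
    now rewrite CV_radius_incr_1, CV_radius_derive.
Qed.

Lemma raney_gf_ge_1 (z : R) : 0 <= z < 27 / 256 -> 1 <= raney_gf 1 z.
Proof.
  intros Hz.
  rewrite raney_gf_equation by (rewrite Rabs_pos_eq; lra).
  replace (raney_gf 1 z ^ 4) with ((raney_gf 1 z ^ 2) ^ 2) by ring.
  pose proof (Rmult_le_pos z _ (proj1 Hz) (pow2_ge_0 (raney_gf 1 z ^ 2))); lra.
Qed.

(** The partial sums give W <= 4/3, and equality would make the left side of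
    W' (4-3W) = W^5 vanish while W is positive. *)
Lemma raney_gf_lt (z : R) : 0 <= z < 27 / 256 -> raney_gf 1 z < 4 / 3.
Proof.
  intros Hz.
  assert (Habs : Rabs z < 27 / 256) by (rewrite Rabs_pos_eq; lra).
  assert (Hle : Rbar_le (raney_gf 1 z) (4 / 3)).
  { apply (is_lim_seq_le (sum_n (fun n => raney n 1 * z ^ n)) (fun _ => 4 / 3)).
    - intros N; rewrite sum_n_Reals.
      apply Rle_trans with (2 := Req_le _ _ (pow_1 (4 / 3))).
      apply Rle_trans with (2 := raney_partial_sum_le N 1).
      apply sum_Rle; intros n _.
      apply Rmult_le_compat_l; [apply raney_pos | apply pow_incr; lra].
    - exact (is_series_raney 1 z Habs).
    - apply is_lim_seq_const. }
  simpl in Hle.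
  destruct (raney_gf_derive z Habs) as [W' [_ [HW' _]]].
  destruct Hle as [Hlt | Heq]; [exact Hlt |].
  rewrite Heq in HW'; lra.
Qed.

(** * Termwise integration *)

(** Termwise integration under a summable bound, in the form of primitives: by
    the mean value theorem, J minus a partial sum of the p k varies on [0,1] by
    at most the corresponding tail of M.  Convergence of the derivatives is only
    asked in the open interval because the integrands below take the form 0/0
    at x = 1. *)
Lemma is_series_of_primitives (p p' : nat -> R -> R) (J J' : R -> R) (M : nat -> R) :
  (forall k x, 0 <= x <= 1 -> is_derive (p k) x (p' k x)) ->
  (forall x, 0 <= x <= 1 -> is_derive J x (J' x)) ->
  (forall k x, 0 < x < 1 -> Rabs (p' k x) <= M k) ->
  ex_series M ->
  (forall x, 0 < x < 1 -> is_series (fun k => p' k x) (J' x)) ->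
  is_series (fun k => p k 1 - p k 0) (J 1 - J 0).
Proof.
  intros Hp HJ HM [L HL] Hser.
  apply filterlim_locally; intros eps.
  assert (HL' := proj1 (filterlim_locally _ _) HL eps).
  destruct HL' as [N HN]; exists N; intros n Hn; specialize (HN n Hn).
  destruct (MVT_cor2 (fun x => J x - sum_n (fun k => p k x) n)
    (fun x => J' x - sum_n (fun k => p' k x) n) 0 1 Rlt_0_1) as [c [Hc Hc01]].
  { intros c Hc; apply is_derive_Reals.
    apply (is_derive_minus (V := R_NormedModule)); [now apply HJ |].
    apply (is_derive_sum_n (V := R_NormedModule)); intros k _; now apply Hp. }
  change (Rabs (sum_n (fun k => p k 1 - p k 0) n - (J 1 - J 0)) < eps).
  change (Rabs (sum_n M n - L) < eps) in HN.
  replace (sum_n (fun k => p k 1 - p k 0) n - (J 1 - J 0))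
    with (sum_n (fun k => p' k c) n - J' c).
  2: { replace (sum_n (fun k => p k 1 - p k 0) n)
         with (sum_n (fun k => p k 1) n - sum_n (fun k => p k 0) n); [lra |].
       rewrite !sum_n_Reals; symmetry; apply minus_sum. }
  apply Rle_lt_trans with (2 := HN).
  assert (Htail : forall (a : nat -> R) (l : R), is_series a l ->
    is_series (fun k => a (S n + k)%nat) (l - sum_n a n)).
  { intros a l Ha; apply is_series_incr_n; [lia |].
    change (is_series a (l - sum_n a n + sum_n a n)).
    unfold Rminus; rewrite Rplus_assoc, Rplus_opp_l, Rplus_0_r; exact Ha. }
  specialize (Htail _ _ HL) as HtM.
  specialize (Htail _ _ (Hser c Hc01)) as Htp.
  rewrite (Rabs_minus_sym _ (J' c)), (Rabs_minus_sym _ L).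
  rewrite <- (is_series_unique _ _ Htp), <- (is_series_unique _ _ HtM).
  apply Rle_trans with (2 := Rle_abs _).
  assert (Hex : ex_series (fun k => M (S n + k)%nat)) by (eexists; exact HtM).
  eapply Rle_trans; [apply Series_Rabs |].
  - apply (ex_series_le (V := R_CompleteNormedModule)) with (2 := Hex); intros k.
    unfold norm; simpl; unfold abs; simpl; rewrite Rabs_Rabsolu; now apply HM.
  - apply Series_le; [| exact Hex].
    intros k; split; [apply Rabs_pos | now apply HM].
Qed.

(** * Series that are rational in W *)

Definition coef (k : nat) : R :=
  binom (4 * k) k / ((3 * INR k + 1) * (3 * INR k + 2)).

Lemma raney_1_coef (k : nat) : raney k 1 = (3 * INR k + 2) * coef k.
Proof.
  unfold coef; rewrite binom_4k_k; pose proof (pos_INR k); field; lra.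
Qed.

Lemma raney_2_coef (k : nat) : raney k 2 = (8 * INR k + 2) * coef k.
Proof.
  pose proof (pos_INR k).
  apply Rmult_eq_reg_l with (3 * INR k + 2); [| lra].
  rewrite raney_2, raney_1_coef; ring.
Qed.

Lemma coef_pos (k : nat) : 0 <= coef k.
Proof.
  pose proof (raney_pos k 1) as H; rewrite raney_1_coef in H.
  pose proof (pos_INR k).
  apply Rmult_le_reg_l with (3 * INR k + 2); lra.
Qed.

Lemma is_series_lincomb (a b : R) (f g h : nat -> R) (lf lg l : R) :
  is_series f lf -> is_series g lg ->
  (forall k, h k = a * f k + b * g k) -> l = a * lf + b * lg ->
  is_series h l.
Proof.
  intros Hf Hg Hh ->.
  apply is_series_ext with (fun k => a * f k + b * g k); [intros k; now rewrite Hh |].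
  apply (is_series_plus (V := R_NormedModule));
    now apply (is_series_scal_l (V := R_NormedModule)).
Qed.

Lemma is_series_coef (z : R) :
  Rabs z < 27 / 256 ->
  is_series (fun k => coef k * z ^ k) ((8 * raney_gf 1 z - 3 * raney_gf 1 z ^ 2) / 10).
Proof.
  intros Hz.
  apply (is_series_lincomb (4 / 5) (- (3 / 10)) _ _ _ _ _ _
    (is_series_raney 1 z Hz) (is_series_raney 2 z Hz)).
  - intros k; rewrite raney_1_coef, raney_2_coef; field.
  - rewrite raney_gf_2 by exact Hz; field.
Qed.

Lemma is_series_INR_coef (z : R) :
  Rabs z < 27 / 256 ->
  is_series (fun k => INR k * coef k * z ^ k) ((raney_gf 1 z ^ 2 - raney_gf 1 z) / 5).
Proof.
  intros Hz.
  apply (is_series_lincomb (- (1 / 5)) (1 / 5) _ _ _ _ _ _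
    (is_series_raney 1 z Hz) (is_series_raney 2 z Hz)).
  - intros k; rewrite raney_1_coef, raney_2_coef; field.
  - rewrite raney_gf_2 by exact Hz; field.
Qed.

(** The factor that multiplies the harmonic numbers in all three identities, up to
    the power of 16. *)
Definition weight (k : nat) : R := (11 * INR k ^ 2 + 8 * INR k + 1) * coef k.

(** With c_k the coefficient of W, division of P by 3k+2 gives
    P(k) coef k = (11/9)(3k+1) c_k - (3k + 13/9) coef k; the series of k c_k is
    z W' = W(W-1)/(4-3W). *)
Lemma is_series_weight (z : R) :
  0 <= z < 27 / 256 ->
  is_series (fun k => weight k * z ^ k)
    ((raney_gf 1 z ^ 3 / 2 + raney_gf 1 z ^ 2 - raney_gf 1 z) / (4 - 3 * raney_gf 1 z)).
Proof.
  intros Hz.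
  assert (Habs : Rabs z < 27 / 256) by (rewrite Rabs_pos_eq; lra).
  destruct (raney_gf_derive z Habs) as [W' [_ [HW' Hser]]].
  pose proof (raney_gf_lt z Hz); pose proof (raney_gf_ge_1 z Hz).
  pose proof (raney_gf_equation z Habs).
  assert (HzW' : z * W' =
    raney_gf 1 z * (raney_gf 1 z - 1) / (4 - 3 * raney_gf 1 z)).
  { apply Rmult_eq_reg_r with (4 - 3 * raney_gf 1 z); [| lra].
    rewrite Rmult_assoc, HW'.
    replace (raney_gf 1 z - 1) with (z * raney_gf 1 z ^ 4) by lra.
    field; lra. }
  pose proof (is_series_lincomb (11 / 3) (11 / 9) _ _ _ _ _ _ Hser
    (is_series_raney 1 z Habs) (fun _ => eq_refl) eq_refl) as Hquad.
  pose proof (is_series_lincomb (- 3) (- (13 / 9)) _ _ _ _ _ _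
    (is_series_INR_coef z Habs) (is_series_coef z Habs) (fun _ => eq_refl) eq_refl)
    as Hlin.
  apply (is_series_lincomb 1 1 _ _ _ _ _ _ Hquad Hlin).
  - intros k; unfold weight; cbv beta; rewrite raney_1_coef; field.
  - rewrite HzW'; field; lra.
Qed.

Lemma weight_bound (k : nat) : 0 <= weight k <= 11 / 9 * (3 * INR k + 1) * raney k 1.
Proof.
  rewrite raney_1_coef; unfold weight.
  pose proof (coef_pos k); pose proof (pos_INR k).
  pose proof (pow2_ge_0 (INR k)).
  split; [apply Rmult_le_pos; lra |].
  rewrite <- Rmult_assoc; apply Rmult_le_compat_r; [assumption |].
  replace (11 / 9 * (3 * INR k + 1) * (3 * INR k + 2))
    with (11 * INR k ^ 2 + 11 * INR k + 22 / 9) by field.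
  lra.
Qed.

(** The dominating series for the termwise integration below: on [0,1] the
    integrand whose integral is H_{dk} is at most 4k. *)
Lemma ex_series_INR_weight : ex_series (fun k => 4 * INR k * (weight k / 16 ^ k)).
Proof.
  apply (ex_series_le (V := R_CompleteNormedModule)) with
    (fun k => 20 * (INR k * (INR k * raney k 1) * (/ 16) ^ k)).
  - intros k; pose proof (weight_bound k) as Hk; pose proof (pos_INR k).
    assert (H16 : 0 < (/ 16) ^ k) by (apply pow_lt; lra).
    unfold norm; simpl; unfold abs; simpl.
    rewrite pow_inv in *; unfold Rdiv.
    rewrite Rabs_pos_eq
      by (apply Rmult_le_pos; [lra | apply Rmult_le_pos; lra]).
    rewrite <- !Rmult_assoc; apply Rmult_le_compat_r; [lra |].
    (* 20 is rounded up from 4 * (11/9) * 4, using 3k^2+k <= 4k^2. *)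
    apply Rle_trans with (4 * INR k * (11 / 9 * (3 * INR k + 1) * raney k 1));
      [apply Rmult_le_compat_l; lra |].
    pose proof (raney_pos k 1).
    rewrite <- !Rmult_assoc; apply Rmult_le_compat_r; [assumption |].
    destruct k as [|k]; [simpl; lra |].
    rewrite S_INR in *; pose proof (pos_INR k); nra.
  - apply (ex_series_scal_l (V := R_NormedModule) 20).
    assert (H : ex_pseries (fun k => INR k * (INR k * raney k 1)) (/ 16)).
    { apply CV_radius_inside; rewrite !CV_radius_INR_mult.
      apply raney_CV_radius; rewrite Rabs_pos_eq; lra. }
    destruct H as [l Hl]; exists l; now apply is_pseries_R in Hl.
Qed.

(** * Uniformization *)

(** The parameter v = x W(x^4/16) / 2 of the curve x = 2v/(1+v^4), W = 1+v^4.
    Fourth powers of x make H_k, H_{2k} and H_{4k} integrals in one variable. *)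
Definition uniformizer (x : R) : R := x * raney_gf 1 (x ^ 4 / 16) / 2.

Lemma pow4_div16 (x : R) : 0 <= x <= 1 -> 0 <= x ^ 4 / 16 < 27 / 256.
Proof.
  intros Hx; pose proof (pow_le x 4 (proj1 Hx)).
  pose proof (pow_incr x 1 4 Hx) as H1; rewrite pow1 in H1; lra.
Qed.

Lemma raney_gf_uniformizer (x : R) :
  0 <= x <= 1 -> raney_gf 1 (x ^ 4 / 16) = 1 + uniformizer x ^ 4.
Proof.
  intros Hx; pose proof (pow4_div16 x Hx).
  rewrite raney_gf_equation at 1 by (rewrite Rabs_pos_eq; lra).
  unfold uniformizer; field.
Qed.

Lemma uniformizer_equation (x : R) :
  0 <= x <= 1 -> x * (1 + uniformizer x ^ 4) = 2 * uniformizer x.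
Proof.
  intros Hx; rewrite <- raney_gf_uniformizer by exact Hx; unfold uniformizer; field.
Qed.

Lemma uniformizer_bound (x : R) :
  0 <= x <= 1 -> 0 <= uniformizer x /\ uniformizer x ^ 4 < 1 / 3.
Proof.
  intros Hx; pose proof (raney_gf_ge_1 _ (pow4_div16 x Hx)).
  pose proof (raney_gf_lt _ (pow4_div16 x Hx)) as Hlt.
  rewrite raney_gf_uniformizer in Hlt by exact Hx.
  split; [| lra].
  unfold uniformizer; apply Rmult_le_pos; [apply Rmult_le_pos |]; lra.
Qed.

(** This is the inverse of dx/dv = 2(1-3v^4)/(1+v^4)^2, obtained here from the
    formula for W'. *)
Lemma uniformizer_derive (x : R) :
  0 <= x <= 1 ->
  is_derive uniformizer x
    ((1 + uniformizer x ^ 4) ^ 2 / (2 * (1 - 3 * uniformizer x ^ 4))).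
Proof.
  intros Hx; pose proof (pow4_div16 x Hx) as Hz.
  assert (Habs : Rabs (x ^ 4 / 16) < 27 / 256) by (rewrite Rabs_pos_eq; lra).
  destruct (raney_gf_derive _ Habs) as [W' [HW [HW' _]]].
  pose proof (raney_gf_lt _ Hz).
  pose proof (raney_gf_equation _ Habs) as Heq.
  replace (uniformizer x ^ 4) with (raney_gf 1 (x ^ 4 / 16) - 1)
    by (rewrite raney_gf_uniformizer by exact Hx; ring).
  set (W := raney_gf 1 (x ^ 4 / 16)) in *.
  assert (Hder : is_derive uniformizer x (W / 2 + x ^ 4 / 8 * W')).
  { unfold uniformizer; auto_derive.
    - exists W'; exact HW.
    - change (x * (x * (x * (x * 1))) * / 16) with (x ^ 4 / 16).
      change (Derive (fun t => raney_gf 1 t)) with (Derive (raney_gf 1)).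
      rewrite (is_derive_unique _ _ _ HW); fold W; field. }
  replace ((1 + (W - 1)) ^ 2 / (2 * (1 - 3 * (W - 1)))) with (W / 2 + x ^ 4 / 8 * W');
    [exact Hder |].
  assert (HW'' : W' = W ^ 5 / (4 - 3 * W)).
  { apply Rmult_eq_reg_r with (4 - 3 * W); [| lra]. rewrite HW'; field; lra. }
  rewrite HW''.
  replace (x ^ 4 / 8 * (W ^ 5 / (4 - 3 * W)))
    with (2 * (x ^ 4 / 16 * W ^ 4) * W / (4 - 3 * W)) by (field; lra).
  replace (x ^ 4 / 16 * W ^ 4) with (W - 1) by lra.
  field; lra.
Qed.

(** * Harmonic numbers as integrals *)

(** Interpolates between 0 at x = 0 and the N-th harmonic number at x = 1. *)
Definition harmonic_poly (e N : nat) (x : R) : R :=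
  sum_n_m (fun m => x ^ (e * m) / INR m) 1 N.

Lemma harmonic_poly_1 (e N : nat) : harmonic_poly e N 1 = harmonic N.
Proof.
  apply sum_n_m_ext; intros m; rewrite pow1; apply Rmult_1_l.
Qed.

Lemma harmonic_poly_0 (e N : nat) : (0 < e)%nat -> harmonic_poly e N 0 = 0.
Proof.
  intros He; unfold harmonic_poly.
  rewrite (sum_n_m_ext_loc _ (fun _ => 0));
    [exact (sum_n_m_const_zero (G := R_AbelianMonoid) 1 N) |].
  intros m Hm; rewrite pow_i by lia; apply Rmult_0_l.
Qed.

Definition harmonic_poly' (e N : nat) (x : R) : R :=
  sum_n_m (fun m => INR e * x ^ (e * m - 1)) 1 N.

Lemma harmonic_poly_derive (e N : nat) (x : R) :
  is_derive (harmonic_poly e N) x (harmonic_poly' e N x).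
Proof.
  unfold harmonic_poly, harmonic_poly'.
  induction N as [|N IHN].
  - apply is_derive_ext with (fun _ => 0).
    + intros t; symmetry; apply (sum_n_m_zero (G := R_AbelianMonoid)); lia.
    + rewrite sum_n_m_zero by lia; apply (is_derive_const (V := R_NormedModule)).
  - apply is_derive_ext with
      (fun t => plus (sum_n_m (fun m => t ^ (e * m) / INR m) 1 N)
                     (t ^ (e * S N) / INR (S N))).
    + intros t; symmetry; apply (sum_n_Sm (G := R_AbelianMonoid)); lia.
    + rewrite sum_n_Sm by lia.
      apply (is_derive_plus (V := R_NormedModule)); [exact IHN |].
      assert (HN : INR (S N) <> 0) by (apply not_0_INR; lia).
      auto_derive; [exact I |].
      rewrite mult_INR, Nat.sub_1_r.
      change (1 * (INR e * INR (S N) * x ^ pred (e * S N)) * / INR (S N)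
        = INR e * x ^ pred (e * S N)).
      field; exact HN.
Qed.

Lemma harmonic_poly'_geometric (e N : nat) (x : R) :
  (0 < e)%nat ->
  harmonic_poly' e N x * (1 - x ^ e) = INR e * x ^ (e - 1) * (1 - x ^ (e * N)).
Proof.
  intros He; unfold harmonic_poly'; induction N as [|N IHN].
  - rewrite sum_n_m_zero, Nat.mul_0_r by lia; unfold zero; simpl; ring.
  - rewrite sum_n_Sm by lia; unfold plus; simpl.
    rewrite Rmult_plus_distr_r, IHN.
    replace (e * S N - 1)%nat with (e - 1 + e * N)%nat by lia.
    replace (e * S N)%nat with (e + e * N)%nat by lia.
    rewrite !pow_add; ring.
Qed.

Lemma harmonic_poly'_bound (e N : nat) (x : R) :
  0 <= x <= 1 -> 0 <= harmonic_poly' e N x <= INR (e * N).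
Proof.
  intros Hx; unfold harmonic_poly'; induction N as [|N IHN].
  - rewrite sum_n_m_zero, Nat.mul_0_r by lia; unfold zero; simpl; lra.
  - rewrite sum_n_Sm by lia; unfold plus; simpl.
    replace (INR (e * S N)) with (INR (e * N) + INR e)
      by (rewrite <- plus_INR; f_equal; lia).
    assert (0 <= x ^ (e * S N - 1) <= 1).
    { split; [apply pow_le; lra |].
      rewrite <- (pow1 (e * S N - 1)); apply pow_incr; lra. }
    pose proof (pos_INR e); nra.
Qed.

Lemma uniformizer_0 : uniformizer 0 = 0.
Proof. unfold uniformizer; lra. Qed.

(** At x = 1 the equation of the uniformizer is u^4 - 2u + 1 = 0, whose left side
    is (u-1)(u^3+u^2+u-1); the bound u^4 < 1/3 excludes u = 1. *)
Lemma uniformizer_1_root :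
  let u := uniformizer 1 in 0 < u < 1 /\ u ^ 3 + u ^ 2 + u = 1.
Proof.
  intros u.
  pose proof (uniformizer_equation 1 ltac:(lra)) as Heq.
  destruct (uniformizer_bound 1 ltac:(lra)) as [H0 H4]; fold u in Heq, H0, H4.
  assert (H1 : u < 1).
  { destruct (Rlt_le_dec u 1) as [H | H]; [exact H |].
    pose proof (pow_R1_Rle u 4 H); lra. }
  pose proof (pow_le u 4 H0).
  split; [lra |].
  apply Rmult_eq_reg_l with (u - 1); [| lra].
  replace ((u - 1) * (u ^ 3 + u ^ 2 + u)) with (u ^ 4 - u) by ring; lra.
Qed.

Lemma raney_gf_critical : raney_gf 1 (/ 16) = 2 * uniformizer 1.
Proof. unfold uniformizer; rewrite pow1; unfold Rdiv; rewrite !Rmult_1_l; field. Qed.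

(** The choice of P makes this sum equal to 1: the numerator of 1 - f contains
    the cubic satisfied by W(1/16). *)
Lemma is_series_weight_critical : is_series (fun k => weight k / 16 ^ k) 1.
Proof.
  pose proof (is_series_weight (/ 16) ltac:(lra)) as H.
  destruct uniformizer_1_root as [Hu Hroot].
  pose proof (raney_gf_lt (/ 16) ltac:(lra)).
  rewrite raney_gf_critical in *.
  set (u := uniformizer 1) in *.
  replace 1 with (((2 * u) ^ 3 / 2 + (2 * u) ^ 2 - 2 * u) / (4 - 3 * (2 * u))).
  - apply is_series_ext with (2 := H); intros k; rewrite pow_inv; reflexivity.
  - apply Rmult_eq_reg_r with (4 - 3 * (2 * u)); [| lra].
    unfold Rdiv; rewrite Rmult_assoc, Rinv_l by lra; lra.
Qed.

(** The sum of the derivatives is e x^(e-1) (1 - f(x^4/16)) / (1-x^e), which is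
    g(x) (1 - f(x^4/16)) / (1-x^4) for the polynomial
    g(x) = e x^(e-1) (1 + x^e + ... + x^(4-e)).  Expressed in v, the quotient
    (1-f)/(1-x^4) times dx/dv is (1+v^4)^2/(1-v^4), whence the condition on the
    primitive F. *)
Lemma is_series_weight_harmonic (d e : nat) (g F F' : R -> R) :
  (d * e = 4)%nat ->
  (forall x, g x * (1 - x ^ e) = INR e * x ^ (e - 1) * (1 - x ^ 4)) ->
  (forall v, 0 <= v < 1 -> is_derive F v (F' v)) ->
  (forall v, 0 <= v < 1 ->
     F' v = g (2 * v / (1 + v ^ 4)) * (1 + v ^ 4) ^ 2 / (1 - v ^ 4)) ->
  is_series (fun k => weight k / 16 ^ k * harmonic (d * k)) (F (uniformizer 1) - F 0).
Proof.
  intros Hde Hg HF HF'.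
  assert (He : (0 < e)%nat) by lia.
  assert (Hedk : forall k, (e * (d * k) = 4 * k)%nat).
  { intros k; now rewrite Nat.mul_assoc, (Nat.mul_comm e), Hde. }
  assert (Hv : forall x, 0 <= x <= 1 -> 0 <= uniformizer x < 1).
  { intros x Hx; destruct (uniformizer_bound x Hx) as [H0 H4]; split; [exact H0 |].
    destruct (Rlt_le_dec (uniformizer x) 1) as [H | H]; [exact H |].
    pose proof (pow_R1_Rle _ 4 H); lra. }
  rewrite <- uniformizer_0.
  apply is_series_ext with (fun k => weight k / 16 ^ k * harmonic_poly e (d * k) 1
    - weight k / 16 ^ k * harmonic_poly e (d * k) 0).
  { intros k; rewrite harmonic_poly_1, harmonic_poly_0 by exact He.
    rewrite Rmult_0_r; apply Rminus_0_r. }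
  apply (is_series_of_primitives
    (fun k x => weight k / 16 ^ k * harmonic_poly e (d * k) x)
    (fun k x => weight k / 16 ^ k * harmonic_poly' e (d * k) x)
    (fun x => F (uniformizer x))
    (fun x => (1 + uniformizer x ^ 4) ^ 2 / (2 * (1 - 3 * uniformizer x ^ 4))
       * F' (uniformizer x))
    (fun k => 4 * INR k * (weight k / 16 ^ k))).
  - intros k x _; apply (is_derive_scal (harmonic_poly e (d * k))).
    apply harmonic_poly_derive.
  - intros x Hx.
    apply (is_derive_comp (V := R_NormedModule) F uniformizer);
      [now apply HF, Hv | now apply uniformizer_derive].
  - intros k x Hx.
    assert (Hw : 0 <= weight k / 16 ^ k).
    { apply Rle_mult_inv_pos; [apply weight_bound | apply pow_lt; lra]. }
    destruct (harmonic_poly'_bound e (d * k) x ltac:(lra)) as [Hp0 Hp].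
    rewrite Hedk, mult_INR in Hp; simpl (INR 4) in Hp.
    rewrite Rabs_pos_eq by (apply Rmult_le_pos; assumption).
    rewrite (Rmult_comm (weight k / 16 ^ k)); apply Rmult_le_compat_r; lra.
  - exact ex_series_INR_weight.
  - intros x Hx.
    assert (Hx' : 0 <= x <= 1) by lra.
    assert (Hxe : x ^ e < 1) by (apply pow_lt_1_compat; lra || lia).
    apply (is_series_lincomb (INR e * x ^ (e - 1) / (1 - x ^ e))
      (- (INR e * x ^ (e - 1) / (1 - x ^ e))) _ _ _ _ _ _
      is_series_weight_critical (is_series_weight (x ^ 4 / 16) (pow4_div16 x Hx'))).
    + intros k.
      replace (harmonic_poly' e (d * k) x)
        with (INR e * x ^ (e - 1) / (1 - x ^ e) * (1 - x ^ (4 * k))).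
      * unfold Rdiv; rewrite Rpow_mult_distr, <- pow_mult, !pow_inv; ring.
      * apply Rmult_eq_reg_r with (1 - x ^ e); [| lra].
        rewrite harmonic_poly'_geometric by exact He.
        rewrite Hedk; field; lra.
    + rewrite HF' by now apply Hv.
      rewrite raney_gf_uniformizer by exact Hx'.
      pose proof (uniformizer_equation x Hx') as Heq.
      destruct (uniformizer_bound x Hx') as [H0 H4].
      pose proof (pow_le _ 4 H0).
      set (v := uniformizer x) in *.
      replace (2 * v / (1 + v ^ 4)) with x
        by (rewrite <- Heq; field; lra).
      replace (g x) with (INR e * x ^ (e - 1) / (1 - x ^ e) * (1 - x ^ 4)).
      2: { apply Rmult_eq_reg_r with (1 - x ^ e); [rewrite Hg; field; lra | lra]. }
      replace (x ^ 4) with (16 * v ^ 4 / (1 + v ^ 4) ^ 4).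
      2: { replace (16 * v ^ 4) with ((2 * v) ^ 4) by ring.
           rewrite <- Heq; field; lra. }
      set (c := INR e * x ^ (e - 1) / (1 - x ^ e)).
      field; lra.
Qed.

(** * The primitives *)

(** These three functions are the primitives of g(2v/(1+v^4)) (1+v^4)^2/(1-v^4)
    for the polynomials g attached to H_k, H_{2k} and H_{4k}.  For H_{4k}, the
    terms 1 and x^2 of g = 1+x+x^2+x^3 contribute opposite multiples of the
    arctangent of v, so only logarithms survive. *)
Definition prim_H1 (v : R) : R := 4 * (ln (1 + v ^ 4) - ln (1 - v ^ 4)).

Definition prim_H2 (v : R) : R :=
  - 2 * v ^ 2 + 2 * (ln (1 + v ^ 2) - ln (1 - v ^ 2))
  + 2 * (ln (1 + v ^ 4) - ln (1 - v ^ 4)).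

Definition prim_H4 (v : R) : R :=
  - v ^ 5 / 5 - 3 * v - v ^ 2 + 2 * (ln (1 + v) - ln (1 - v))
  + (ln (1 + v ^ 2) - ln (1 - v ^ 2)) + (ln (1 + v ^ 4) - ln (1 - v ^ 4)).

Lemma pow_bounds (v : R) (n : nat) : 0 <= v < 1 -> 0 <= v ^ S n < 1.
Proof.
  intros Hv; split; [apply pow_le; lra | apply pow_lt_1_compat; [lra | lia]].
Qed.

Lemma is_series_harmonic_k :
  is_series (fun k => weight k / 16 ^ k * harmonic k) (prim_H1 (uniformizer 1)).
Proof.
  replace (prim_H1 (uniformizer 1)) with (prim_H1 (uniformizer 1) - prim_H1 0).
  2: { unfold prim_H1 at 2; rewrite pow_i, !Rplus_0_r, !Rminus_0_r, ln_1 by lia; ring. }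
  apply is_series_ext with (fun k => weight k / 16 ^ k * harmonic (1 * k)).
  { intros k; now rewrite Nat.mul_1_l. }
  apply (is_series_weight_harmonic 1 4 (fun x => 4 * x ^ 3) prim_H1
    (fun v => 32 * v ^ 3 / ((1 + v ^ 4) * (1 - v ^ 4)))).
  - reflexivity.
  - intros x; simpl; ring.
  - intros v Hv; pose proof (pow_bounds v 3 Hv).
    unfold prim_H1; auto_derive; [simpl in *; repeat split; lra |].
    field; simpl in *; lra.
  - intros v Hv; pose proof (pow_bounds v 3 Hv); field; simpl in *; lra.
Qed.

Lemma is_series_harmonic_2k :
  is_series (fun k => weight k / 16 ^ k * harmonic (2 * k)) (prim_H2 (uniformizer 1)).
Proof.
  replace (prim_H2 (uniformizer 1)) with (prim_H2 (uniformizer 1) - prim_H2 0).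
  2: { unfold prim_H2 at 2; rewrite !pow_i, !Rplus_0_r, !Rminus_0_r, ln_1 by lia; ring. }
  apply (is_series_weight_harmonic 2 2 (fun x => 2 * x * (1 + x ^ 2)) prim_H2
    (fun v => - 4 * v + 8 * v / ((1 + v ^ 2) * (1 - v ^ 2))
      + 16 * v ^ 3 / ((1 + v ^ 4) * (1 - v ^ 4)))).
  - reflexivity.
  - intros x; simpl; ring.
  - intros v Hv; pose proof (pow_bounds v 1 Hv); pose proof (pow_bounds v 3 Hv).
    unfold prim_H2; auto_derive; [simpl in *; repeat split; lra |].
    field; simpl in *; lra.
  - intros v Hv; pose proof (pow_bounds v 1 Hv); pose proof (pow_bounds v 3 Hv).
    field; simpl in *; lra.
Qed.

Lemma is_series_harmonic_4k :
  is_series (fun k => weight k / 16 ^ k * harmonic (4 * k)) (prim_H4 (uniformizer 1)).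
Proof.
  replace (prim_H4 (uniformizer 1)) with (prim_H4 (uniformizer 1) - prim_H4 0).
  2: { unfold prim_H4 at 2; rewrite !pow_i, !Rplus_0_r, !Rminus_0_r, ln_1 by lia; field. }
  apply (is_series_weight_harmonic 4 1 (fun x => (1 + x) * (1 + x ^ 2)) prim_H4
    (fun v => - v ^ 4 - 3 - 2 * v + 4 / ((1 + v) * (1 - v))
      + 4 * v / ((1 + v ^ 2) * (1 - v ^ 2))
      + 8 * v ^ 3 / ((1 + v ^ 4) * (1 - v ^ 4)))).
  - reflexivity.
  - intros x; simpl; ring.
  - intros v Hv; pose proof (pow_bounds v 1 Hv); pose proof (pow_bounds v 3 Hv).
    unfold prim_H4; auto_derive; [simpl in *; repeat split; lra |].
    field; simpl in *; lra.
  - intros v Hv; pose proof (pow_bounds v 1 Hv); pose proof (pow_bounds v 3 Hv).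
    field; simpl in *; lra.
Qed.

(** The primitive of 4 (E - 1/2) / x expressed in v, where E = (8W-3W^2)/10 is
    the series of [coef] and 1/2 its constant term. *)
Definition prim_inv (v : R) : R :=
  9 / 20 * v ^ 8 - 9 / 5 * v ^ 4 + 2 * ln (1 + v ^ 4).

Lemma coef_0 : coef 0 = / 2.
Proof.
  pose proof (raney_1_coef 0) as H; simpl in H; lra.
Qed.

Lemma is_series_tail (f : nat -> R) (l : R) :
  is_series f l -> is_series (fun j => f (S j)) (l - f 0%nat).
Proof.
  intros Hf; apply (is_series_incr_1 (V := R_NormedModule)).
  change (is_series f (l - f 0%nat + f 0%nat)).
  unfold Rminus; rewrite Rplus_assoc, Rplus_opp_l, Rplus_0_r; exact Hf.
Qed.

Lemma is_series_coef_div_k :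
  is_series (fun j => coef (S j) / 16 ^ S j / INR (S j)) (prim_inv (uniformizer 1)).
Proof.
  replace (prim_inv (uniformizer 1))
    with (prim_inv (uniformizer 1) - prim_inv (uniformizer 0)).
  2: { rewrite uniformizer_0; unfold prim_inv at 2.
       rewrite !pow_i, Rplus_0_r, ln_1 by lia; ring. }
  apply is_series_ext with (fun j => coef (S j) / 16 ^ S j / INR (S j) * 1 ^ (4 * S j)
    - coef (S j) / 16 ^ S j / INR (S j) * 0 ^ (4 * S j)).
  { intros j; rewrite pow1, pow_i by lia; rewrite Rmult_0_r, Rmult_1_r; apply Rminus_0_r. }
  apply (is_series_of_primitives
    (fun j x => coef (S j) / 16 ^ S j / INR (S j) * x ^ (4 * S j))
    (fun j x => 4 * (coef (S j) / 16 ^ S j) * x ^ (4 * S j - 1))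
    (fun x => prim_inv (uniformizer x))
    (fun x => (1 + uniformizer x ^ 4) ^ 2 / (2 * (1 - 3 * uniformizer x ^ 4))
       * (2 * uniformizer x ^ 3 * (2 - 3 * uniformizer x ^ 4)
            * (1 - 3 * uniformizer x ^ 4) / (5 * (1 + uniformizer x ^ 4))))
    (fun j => 4 * (coef (S j) * (/ 16) ^ S j))).
  - intros j x _.
    assert (Hj : INR (S j) <> 0) by (apply not_0_INR; lia).
    replace (4 * (coef (S j) / 16 ^ S j) * x ^ (4 * S j - 1))
      with (coef (S j) / 16 ^ S j / INR (S j) * (INR (4 * S j) * x ^ (4 * S j - 1))).
    2: { rewrite mult_INR; simpl (INR 4); field; split; [apply pow_nonzero; lra | exact Hj]. }
    generalize (coef (S j) / 16 ^ S j / INR (S j)) (4 * S j)%nat; intros c n.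
    auto_derive; [exact I |].
    rewrite Nat.sub_1_r; ring.
  - intros x Hx.
    apply (is_derive_comp (V := R_NormedModule) prim_inv uniformizer);
      [| now apply uniformizer_derive].
    destruct (uniformizer_bound x Hx) as [H0 _]; pose proof (pow_le _ 4 H0).
    set (v := uniformizer x) in *.
    unfold prim_inv; auto_derive; [simpl in *; lra |].
    field; simpl in *; lra.
  - intros j x Hx.
    rewrite pow_inv.
    assert (0 <= coef (S j) / 16 ^ S j).
    { apply Rle_mult_inv_pos; [apply coef_pos | apply pow_lt; lra]. }
    assert (0 <= x ^ (4 * S j - 1) <= 1).
    { split; [apply pow_le; lra |].
      rewrite <- (pow1 (4 * S j - 1)); apply pow_incr; lra. }
    change (coef (S j) * / 16 ^ S j) with (coef (S j) / 16 ^ S j).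
    rewrite Rabs_pos_eq by (apply Rmult_le_pos; lra).
    rewrite <- (Rmult_1_r (4 * (coef (S j) / 16 ^ S j))) at 2.
    apply Rmult_le_compat_l; lra.
  - apply (ex_series_scal_l (V := R_NormedModule) 4).
    apply (ex_series_incr_1 (V := R_NormedModule) (fun j => coef j * (/ 16) ^ j)).
    eexists; apply is_series_coef; rewrite Rabs_pos_eq; lra.
  - intros x Hx.
    assert (Hx' : 0 <= x <= 1) by lra.
    pose proof (pow4_div16 x Hx').
    pose proof (uniformizer_equation x Hx') as Heq.
    destruct (uniformizer_bound x Hx') as [H0 H4].
    pose proof (is_series_tail _ _
      (is_series_coef (x ^ 4 / 16) ltac:(rewrite Rabs_pos_eq; lra))) as Hs.
    cbv beta in Hs; rewrite coef_0, pow_O, Rmult_1_r in Hs.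
    rewrite raney_gf_uniformizer in Hs by exact Hx'.
    pose proof (pow_le _ 4 H0).
    set (v := uniformizer x) in *.
    apply (is_series_lincomb (4 / x) 0 _ _ _ _ _ _ Hs Hs).
    + intros j.
      replace (x ^ (4 * S j - 1)) with ((x ^ 4) ^ S j / x).
      * unfold Rdiv; rewrite Rpow_mult_distr, !pow_inv; field.
        split; [apply pow_nonzero |]; lra.
      * rewrite <- pow_mult.
        replace (4 * S j)%nat with (S (4 * S j - 1)) at 1 by lia.
        simpl pow; field; lra.
    + assert (Hv : 0 < v) by nra.
      replace x with (2 * v / (1 + v ^ 4)) by (rewrite <- Heq; field; lra).
      field; lra.
Qed.

(** * Logarithms at the root of the cubic *)

(** The element 1-u of the cubic field has norm 2, hence its cube is twice a
    unit; the unit is u^5. *)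
Lemma ln_root_one_minus (u : R) :
  0 < u < 1 -> u ^ 3 + u ^ 2 + u = 1 -> ln (1 - u) = (ln 2 + 5 * ln u) / 3.
Proof.
  intros Hu Hroot.
  assert (Hpow : (1 - u) ^ 3 = 2 * u ^ 5).
  { apply Rminus_diag_uniq.
    replace ((1 - u) ^ 3 - 2 * u ^ 5)
      with ((2 * u ^ 2 - 2 * u + 1) * (1 - (u ^ 3 + u ^ 2 + u))) by ring.
    rewrite Hroot; ring. }
  apply (f_equal ln) in Hpow.
  rewrite ln_pow, ln_mult, ln_pow in Hpow by (try apply pow_lt; lra).
  simpl INR in Hpow; lra.
Qed.

(** The cubic reads 1-u = u^2 (1+u). *)
Lemma ln_root_one_plus (u : R) :
  0 < u < 1 -> u ^ 3 + u ^ 2 + u = 1 -> ln (1 + u) = ln (1 - u) - 2 * ln u.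
Proof.
  intros Hu Hroot.
  replace (1 - u) with (u ^ 2 * (1 + u)) by lra.
  rewrite ln_mult, ln_pow by (try apply pow_lt; lra); simpl INR; ring.
Qed.

(** The cubic also reads (1+u)(1+u^2) = 2. *)
Lemma ln_root_one_plus_sq (u : R) :
  0 < u < 1 -> u ^ 3 + u ^ 2 + u = 1 -> ln (1 + u ^ 2) = ln 2 - ln (1 + u).
Proof.
  intros Hu Hroot.
  replace 2 with ((1 + u ^ 2) * (1 + u)) by lra.
  rewrite ln_mult by nra; ring.
Qed.

Lemma pow4_root (u : R) : u ^ 3 + u ^ 2 + u = 1 -> u ^ 4 = 2 * u - 1.
Proof.
  intros Hroot.
  replace (u ^ 4) with ((u - 1) * (u ^ 3 + u ^ 2 + u) + u) by ring.
  rewrite Hroot; ring.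
Qed.

Lemma harmonic_0 : harmonic 0 = 0.
Proof. apply (sum_n_m_zero (G := R_AbelianMonoid)); lia. Qed.

Lemma prim_values_at_root (u : R) :
  0 < u < 1 -> u ^ 3 + u ^ 2 + u = 1 ->
  prim_H1 u = - (8 * ln u + 4 * ln 2) / 3 /\
  prim_H2 u = - 2 * u ^ 2 - (10 * ln u + 2 * ln 2) / 3 /\
  prim_H4 u = - (7 * u ^ 2 + 14 * u) / 5 - (17 * ln u + ln 2) / 3 /\
  prim_inv u = 9 / 20 * (2 * u - 1) ^ 2 - 9 / 5 * (2 * u - 1) + 2 * (ln 2 + ln u).
Proof.
  intros Hu Hroot.
  pose proof (ln_root_one_minus u Hu Hroot) as Hm.
  pose proof (ln_root_one_plus u Hu Hroot) as Hp.
  pose proof (ln_root_one_plus_sq u Hu Hroot) as Hp2.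
  pose proof (pow4_root u Hroot) as H4.
  assert (Hm2 : ln (1 - u ^ 2) = ln (1 - u) + ln (1 + u)).
  { rewrite <- ln_mult by lra; f_equal; ring. }
  assert (Hp4 : ln (1 + u ^ 4) = ln 2 + ln u).
  { rewrite <- ln_mult by lra; f_equal; lra. }
  assert (Hm4 : ln (1 - u ^ 4) = ln 2 + ln (1 - u)).
  { rewrite <- ln_mult by lra; f_equal; lra. }
  assert (H5 : u ^ 5 = 2 * u ^ 2 - u).
  { replace (u ^ 5) with (u * u ^ 4) by ring; rewrite H4; ring. }
  assert (H8 : u ^ 8 = (2 * u - 1) ^ 2).
  { replace (u ^ 8) with ((u ^ 4) ^ 2) by ring; now rewrite H4. }
  unfold prim_H1, prim_H2, prim_H4, prim_inv.
  rewrite H5, H8, Hp4, Hm4, Hm2, Hp2, H4, Hp, Hm.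
  repeat split; field.
Qed.

(** * The three identities *)

Theorem theorem1p2 :
  is_series
    (fun j : nat =>
       let k := S j in
       binom (4 * k) k *
         ((11 * INR k ^ 2 + 8 * INR k + 1) * harmonic k
            + 6 * INR k + 6 + 4 / (3 * INR k)) /
       ((3 * INR k + 1) * (3 * INR k + 2) * 16 ^ k))
    (4 / 3 * ln 2)
  /\
  is_series
    (fun k : nat =>
       binom (4 * k) k *
         ((11 * INR k ^ 2 + 8 * INR k + 1)
            * (harmonic (2 * k) - 5 / 4 * harmonic k)
            + 4 * INR k + 1) /
       ((3 * INR k + 1) * (3 * INR k + 2) * 16 ^ k))
    (ln 2)
  /\
  is_series
    (fun k : nat =>
       binom (4 * k) k *
         ((11 * INR k ^ 2 + 8 * INR k + 1)
            * (10 * harmonic (4 * k) - 17 * harmonic (2 * k))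
            + 2 * INR k + 18) /
       ((3 * INR k + 1) * (3 * INR k + 2) * 16 ^ k))
    (8 * ln 2).
Proof.
  destruct uniformizer_1_root as [Hu Hroot].
  destruct (prim_values_at_root _ Hu Hroot) as (HH1 & HH2 & HH4 & Hinv).
  pose proof is_series_harmonic_k as S1; rewrite HH1 in S1.
  pose proof is_series_harmonic_2k as S2; rewrite HH2 in S2.
  pose proof is_series_harmonic_4k as S4; rewrite HH4 in S4.
  pose proof is_series_coef_div_k as Sinv; rewrite Hinv in Sinv.
  assert (Habs : Rabs (/ 16) < 27 / 256) by (rewrite Rabs_pos_eq; lra).
  pose proof (is_series_coef _ Habs) as S0.
  pose proof (is_series_INR_coef _ Habs) as SK.
  rewrite raney_gf_critical in S0, SK.
  set (u := uniformizer 1) in *.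
  pose proof (fun a b => is_series_lincomb a b _ _ _ _ _ _ SK S0
    (fun _ => eq_refl) eq_refl) as Slin.
  cbv beta in Slin.
  split; [| split].
  - pose proof (is_series_lincomb 1 1 _ _ _ _ _ _ S1 (Slin 6 6)
      (fun _ => eq_refl) eq_refl) as Hsum.
    apply is_series_tail in Hsum.
    apply (is_series_lincomb 1 (4 / 3) _ _ _ _ _ _ Hsum Sinv).
    + intros j; cbv beta zeta; unfold weight, coef.
      assert (Hj : 0 < INR (S j)) by (apply lt_0_INR; lia).
      rewrite pow_inv; field; repeat split; try lra; apply pow_nonzero; lra.
    + cbv beta; rewrite harmonic_0, coef_0, Rmult_0_r; simpl INR; field.
  - pose proof (is_series_lincomb 1 (- (5 / 4)) _ _ _ _ _ _ S2 S1
      (fun _ => eq_refl) eq_refl) as Hsum.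
    apply (is_series_lincomb 1 1 _ _ _ _ _ _ Hsum (Slin 4 1)).
    + intros k; unfold weight, coef; pose proof (pos_INR k).
      rewrite pow_inv; field; repeat split; try lra; apply pow_nonzero; lra.
    + field.
  - pose proof (is_series_lincomb 10 (- 17) _ _ _ _ _ _ S4 S2
      (fun _ => eq_refl) eq_refl) as Hsum.
    apply (is_series_lincomb 1 1 _ _ _ _ _ _ Hsum (Slin 2 18)).
    + intros k; unfold weight, coef; pose proof (pos_INR k).
      rewrite pow_inv; field; repeat split; try lra; apply pow_nonzero; lra.
    + field.
Qed.
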